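(* Let $\sigma>1$, and for $\tau>0$ let $M_p^{\tau,\sigma}=p^{\tau p^\sigma}$ for $p\in\mathbb N$, $M_0^{\tau,\sigma}=1$, and let $\mathcal M_\sigma=\{(M_p^{\tau,\sigma})_{p\in\mathbb N_0}:\tau>0\}$. Then, both in the Roumieu case ($[\mathcal M_\sigma]=\{\mathcal M_\sigma\}$) and in the Beurling case ($[\mathcal M_\sigma]=(\mathcal M_\sigma)$), $$\mathcal S_{[\mathcal M_\sigma]}^{[\mathcal M_\sigma]}(\mathbb R^n)=\mathscr S_{[\mathcal M_\sigma]}^{[\mathcal M_\sigma]}(\mathbb R^n),\qquad \mathcal S^{[\mathcal M_\sigma]}(\mathbb R^n)=\mathscr S^{[\mathcal M_\sigma]}(\mathbb R^n),\qquad \mathcal S_{[\mathcal M_\sigma]}(\mathbb R^n)=\mathscr S_{[\mathcal M_\sigma]}(\mathbb R^n).$$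
   Context: All spaces consist of functions $\varphi\in C^\infty(\mathbb R^n)$; $\alpha,\beta$ denote multi-indices in $\mathbb N_0^n$, $|\alpha|=\alpha_1+\dots+\alpha_n$, and suprema are over $x\in\mathbb R^n$. The spaces $\mathcal S$ (without the factor $h$): Roumieu type: - $\varphi\in\mathcal S^{\{\mathcal M_\sigma\}}(\mathbb R^n)$ iff $(\exists\tau>0)(\forall\alpha)(\exists C_\alpha>0)(\forall\beta)\ \sup_x|x^\alpha\partial^\beta\varphi(x)|\le C_\alpha M^{\tau,\sigma}_{|\beta|}$; - $\varphi\in\mathcal S_{\{\mathcal M_\sigma\}}(\mathbb R^n)$ iff $(\exists\tau>0)(\forall\beta)(\exists C_\beta>0)(\forall\alpha)\ \sup_x|x^\alpha\partial^\beta\varphi(x)|\le C_\beta M^{\tau,\sigma}_{|\alpha|}$; - $\varphi\in\mathcal S_{\{\mathcal M_\sigma\}}^{\{\mathcal M_\sigma\}}(\mathbb R^n)$ iff $(\exists\tau>0)(\exists C>0)(\forall\alpha,\beta)\ \sup_x|x^\alpha\partial^\beta\varphi(x)|\le C M^{\tau,\sigma}_{|\alpha|}M^{\tau,\sigma}_{|\beta|}$. Beurling type: $\mathcal S^{(\mathcal M_\sigma)}(\mathbb R^n)$, $\mathcal S_{(\mathcal M_\sigma)}(\mathbb R^n)$, $\mathcal S_{(\mathcal M_\sigma)}^{(\mathcal M_\sigma)}(\mathbb R^n)$ are defined by the same three conditions with $(\exists\tau>0)$ replaced by $(\forall\tau>0)$ (the constants may then depend on $\tau$). The spaces $\mathscr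 S$ (with the factor $h$): Beurling type: - $\varphi\in\mathscr S_{(\mathcal M_\sigma)}^{(\mathcal M_\sigma)}(\mathbb R^n)$ iff $(\forall\tau>0)(\forall h>0)(\exists C=C_{\tau,h}>0)(\forall\alpha,\beta)\ \sup_x|x^\alpha\partial^\beta\varphi(x)|\le C h^{|\alpha|^\sigma+|\beta|^\sigma}M^{\tau,\sigma}_{|\alpha|}M^{\tau,\sigma}_{|\beta|}$; - $\varphi\in\mathscr S^{(\mathcal M_\sigma)}(\mathbb R^n)$ iff $(\forall\tau>0)(\forall h>0)(\forall\alpha)(\exists C_\alpha>0)(\forall\beta)\ \sup_x|x^\alpha\partial^\beta\varphi(x)|\le C_\alpha h^{|\beta|^\sigma}M^{\tau,\sigma}_{|\beta|}$; - $\varphi\in\mathscr S_{(\mathcal M_\sigma)}(\mathbb R^n)$ iff $(\forall\tau>0)(\forall h>0)(\forall\beta)(\exists C_\beta>0)(\forall\alpha)\ \sup_x|x^\alpha\partial^\beta\varphi(x)|\le C_\beta h^{|\alpha|^\sigma}M^{\tau,\sigma}_{|\alpha|}$. Roumieu type: $\mathscr S_{\{\mathcal M_\sigma\}}^{\{\mathcal M_\sigma\}}(\mathbb R^n)$, $\mathscr S^{\{\mathcal M_\sigma\}}(\mathbb R^n)$, $\mathscr S_{\{\mathcal M_\sigma\}}(\mathbb R^n)$ are defined by the same three conditions with $(\forall\tau>0)(\forall h>0)$ replaced by $(\exists\tau>0)(\exists h>0)$. *)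

(* Defs.v *)
From HB Require Import structures.
From mathcomp Require Import all_boot all_order all_algebra.
From mathcomp Require Import all_classical all_reals all_analysis.
From mathcomp.real_closed Require Import complex.
Set Implicit Arguments.
Unset Strict Implicit.
Unset Printing Implicit Defensive.
Import Order.TTheory GRing.Theory Num.Theory.
Import numFieldNormedType.Exports.
Local Open Scope classical_set_scope.
Local Open Scope ring_scope.

(* Test functions are complex-valued. [Rcomplex R] is R[i] seen as a vector
   space over R, normed by the modulus; the library gives it the structures of
   a left module and of a normed group over R, and what is missing for it to
   be the codomain of ['D_v f] is the topology induced by the modulus. *)
Section RcomplexNormed.
Variable R : realType.

HB.instance Definition _ := isPointed.Build (Rcomplex R) 0.
HB.instance Definition _ :=
  PseudoMetric.copy (Rcomplex R) (pseudoMetric_normed (Rcomplex R)).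
HB.instance Definition _ :=
  NormedZmod_PseudoMetric_eq.Build R (Rcomplex R) erefl.

Lemma Rcomplex_normZ (l : R) (z : Rcomplex R) : `|l *: z| = `|l| * `|z|.
Proof.
case: z => a b.
rewrite -[LHS]/(Num.sqrt ((l * a) ^+ 2 + (l * b) ^+ 2)).
rewrite -[X in _ = _ * X]/(Num.sqrt (a ^+ 2 + b ^+ 2)).
by rewrite !exprMn -mulrDr sqrtrM ?sqr_ge0// sqrtr_sqr.
Qed.

HB.instance Definition _ :=
  PseudoMetricNormedZmod_Lmodule_isNormedModule.Build R (Rcomplex R)
    Rcomplex_normZ.

End RcomplexNormed.

Section Spaces.
Variables (R : realType) (n : nat).

Definition multi_index := {ffun 'I_n -> nat}.
Implicit Types (f phi : 'rV[R]_n -> Rcomplex R) (alpha beta : multi_index).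

Definition mabs alpha : nat := (\sum_i alpha i)%N.

Definition monomial alpha (x : 'rV[R]_n) : R := \prod_i x ord0 i ^+ alpha i.

Definition partial (i : 'I_n) f : 'rV[R]_n -> Rcomplex R :=
  'D_(delta_mx ord0 i) f.

(* The partial derivatives of every order, taken in any succession of
   directions, exist everywhere and are continuous. *)
Definition smooth f : Prop :=
  forall s : seq 'I_n, let g := foldr partial f s in
    continuous g /\ forall x i, derivable g x (delta_mx ord0 i).

Definition mderive beta f : 'rV[R]_n -> Rcomplex R :=
  foldr (fun i => iter (beta i) (partial i)) f (enum 'I_n).

Definition sup_norm alpha beta phi : \bar R :=
  ereal_sup (range (fun x : 'rV[R]_n =>
    (`|(monomial alpha x *: mderive beta phi x : Rcomplex R)|)%:E)).

(* [sigma] comes first and [tau] second, as sigma is fixed throughout while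
   the defining sequence varies with tau. *)
Definition Mseq (sigma tau : R) (p : nat) : R :=
  if p == 0%N then 1 else p%:R `^ (tau * p%:R `^ sigma).

Inductive regime := Roumieu | Beurling.

Definition quant (k : regime) (P : R -> Prop) : Prop :=
  match k with
  | Roumieu => exists t : R, 0 < t /\ P t
  | Beurling => forall t : R, 0 < t -> P t
  end.

(* The suffix [_up] (resp. [_down]) stands for the matrix written as a
   superscript (resp. subscript) of the space. *)

Definition S_both (k : regime) (sigma : R) : set ('rV[R]_n -> Rcomplex R) :=
  [set phi | smooth phi /\ quant k (fun tau =>
    exists C : R, 0 < C /\ forall alpha beta,
      (sup_norm alpha beta phi <=
       (C * Mseq sigma tau (mabs alpha) * Mseq sigma tau (mabs beta))%:E)%E)].

Definition S_up (k : regime) (sigma : R) : set ('rV[R]_n -> Rcomplex R) :=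
  [set phi | smooth phi /\ quant k (fun tau =>
    forall alpha, exists C : R, 0 < C /\ forall beta,
      (sup_norm alpha beta phi <= (C * Mseq sigma tau (mabs beta))%:E)%E)].

Definition S_down (k : regime) (sigma : R) : set ('rV[R]_n -> Rcomplex R) :=
  [set phi | smooth phi /\ quant k (fun tau =>
    forall beta, exists C : R, 0 < C /\ forall alpha,
      (sup_norm alpha beta phi <= (C * Mseq sigma tau (mabs alpha))%:E)%E)].

Definition scrS_both (k : regime) (sigma : R) :
    set ('rV[R]_n -> Rcomplex R) :=
  [set phi | smooth phi /\ quant k (fun tau => quant k (fun h =>
    exists C : R, 0 < C /\ forall alpha beta,
      (sup_norm alpha beta phi <=
       (C * h `^ ((mabs alpha)%:R `^ sigma + (mabs beta)%:R `^ sigma)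
          * Mseq sigma tau (mabs alpha) * Mseq sigma tau (mabs beta))%:E)%E))].

Definition scrS_up (k : regime) (sigma : R) : set ('rV[R]_n -> Rcomplex R) :=
  [set phi | smooth phi /\ quant k (fun tau => quant k (fun h =>
    forall alpha, exists C : R, 0 < C /\ forall beta,
      (sup_norm alpha beta phi <=
       (C * h `^ ((mabs beta)%:R `^ sigma)
          * Mseq sigma tau (mabs beta))%:E)%E))].

Definition scrS_down (k : regime) (sigma : R) : set ('rV[R]_n -> Rcomplex R) :=
  [set phi | smooth phi /\ quant k (fun tau => quant k (fun h =>
    forall beta, exists C : R, 0 < C /\ forall alpha,
      (sup_norm alpha beta phi <=
       (C * h `^ ((mabs alpha)%:R `^ sigma)
          * Mseq sigma tau (mabs alpha))%:E)%E))].

End Spaces.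

(* Main.v *)
Require Import Defs.
From mathcomp Require Import all_boot all_order all_algebra.
From mathcomp Require Import all_classical all_reals all_analysis.
Import Order.TTheory GRing.Theory Num.Theory.
Local Open Scope ring_scope.

(** The factor [h `^ (p `^ sigma)] is absorbed by an arbitrarily small change
    of [tau]: since [p `^ (delta * p `^ sigma) = (p `^ delta) `^ (p `^ sigma)]
    and [p `^ delta] eventually exceeds any given [h], the quotient of
    [h `^ (p `^ sigma) * Mseq sigma tau p] by [Mseq sigma (tau + delta) p] is at
    most 1 for large [p], hence bounded ([geometric_factor_absorbed]).

    Each of the six conditions asks for the same estimate [P w] with a weight
    sequence [w], either [Mseq sigma tau] or its product with the factor in
    [h], and [P] survives the replacement of [w] by a sequence that dominates
    it up to a constant. One passage between the two sides is the choice
    [h = 1]. In the other, the Roumieu case increases [tau], to get rid of a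
    given [h], and the Beurling case starts from a smaller [tau], to gain a
    prescribed [h] ([quant_geometric_factor]). *)

Section GeometricFactor.
Context {R : realType} {sigma : R} (sigma_ge0 : 0 <= sigma).
Implicit Types (h t C : R) (p : nat).

Definition hMseq h t p : R := h `^ (p%:R `^ sigma) * Mseq sigma t p.

Lemma Mseq_ge0 t p : 0 <= Mseq sigma t p.
Proof. by rewrite /Mseq; case: ifP => // _; exact: powR_ge0. Qed.

Lemma hMseq_ge0 h t p : 0 <= hMseq h t p.
Proof. by rewrite mulr_ge0 ?powR_ge0 ?Mseq_ge0. Qed.

Lemma hMseq1 t : hMseq 1 t = Mseq sigma t.
Proof. by apply/funext => p; rewrite /hMseq powR1 mul1r. Qed.

Lemma Mseq_le t1 t2 p : t1 <= t2 -> Mseq sigma t1 p <= Mseq sigma t2 p.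
Proof.
move=> le_t; rewrite /Mseq; case: eqP => // /eqP; rewrite -lt0n => p_gt0.
by apply: ler_powR; rewrite ?ler1n// ler_wpM2r ?powR_ge0.
Qed.

(** The quotient can exceed 1 only below the threshold
    [X = h `^ (t2 - t1)^-1], at which [p `^ (t2 - t1)] reaches [h]; there the
    factor in [h] alone is bounded, and [Mseq] increases with [t]. As [X] is
    positive, [p = 0], where [Mseq] does not follow the formula, lies below. *)
Lemma geometric_factor_absorbed h t1 t2 : 0 < h -> t1 < t2 ->
  exists2 A : R, 0 < A & forall p, hMseq h t1 p <= A * Mseq sigma t2 p.
Proof.
move=> h_gt0 lt_t; have d_gt0 : 0 < t2 - t1 by rewrite subr_gt0.
set X := h `^ (t2 - t1)^-1; have X_gt0 : 0 < X by exact: powR_gt0.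
pose m := Num.max 1 h.
have m_ge1 : 1 <= m by rewrite le_max lexx.
have le_hm : h <= m by rewrite le_max lexx orbT.
have A_ge1 : 1 <= m `^ (X `^ sigma).
  by rewrite -[leLHS](powRr0 m) ler_powR ?powR_ge0.
exists (m `^ (X `^ sigma)) => [|p]; first exact: lt_le_trans A_ge1.
have [le_pX|lt_Xp] := leP p%:R X.
  apply: ler_pM; rewrite ?powR_ge0 ?Mseq_ge0 ?Mseq_le ?(ltW lt_t)//.
  apply: (@le_trans _ _ (m `^ (p%:R `^ sigma))).
    by rewrite ge0_ler_powR ?nnegrE ?powR_ge0 ?(le_trans _ le_hm) ?(ltW h_gt0).
  by rewrite ler_powR// ge0_ler_powR ?nnegrE ?ler0n ?(ltW X_gt0).
apply: (@le_trans _ _ (Mseq sigma t2 p)); last by rewrite ler_peMl ?Mseq_ge0.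
have p_gt0 : 0 < p%:R :> R by exact: lt_trans lt_Xp.
have le_hp : h <= p%:R `^ (t2 - t1).
  have -> : h = X `^ (t2 - t1).
    by rewrite -powRrM mulVf ?gt_eqF// powRr1 ?ltW.
  by rewrite ge0_ler_powR ?nnegrE ?(ltW d_gt0) ?(ltW X_gt0) ?(ltW lt_Xp) ?ler0n.
have p_neq0 : (p == 0)%N = false by apply/negbTE; rewrite -lt0n -(ltr0n R).
rewrite /hMseq /Mseq p_neq0.
have -> : t2 * p%:R `^ sigma =
    (t2 - t1) * p%:R `^ sigma + t1 * p%:R `^ sigma by rewrite -mulrDl subrK.
rewrite powRD ?(gt_eqF p_gt0) ?implybT// ler_wpM2r ?powR_ge0// powRrM.
by rewrite ge0_ler_powR ?nnegrE ?powR_ge0 ?(ltW h_gt0).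
Qed.

(** The previous bound for [h^-1], multiplied by the factor in [h]. *)
Lemma geometric_factor_gained h t1 t2 : 0 < h -> t1 < t2 ->
  exists2 A : R, 0 < A & forall p, Mseq sigma t1 p <= A * hMseq h t2 p.
Proof.
move=> h_gt0 lt_t.
have hV_gt0 : 0 < h^-1 by rewrite invr_gt0.
have [A A_gt0 le_A] := geometric_factor_absorbed _ _ _ hV_gt0 lt_t.
exists A => // p; rewrite /hMseq mulrCA.
apply: le_trans (ler_wpM2l (powR_ge0 h (p%:R `^ sigma)) (le_A p)).
rewrite /hMseq mulrA -powRM ?invr_ge0 ?(ltW h_gt0)// divff ?gt_eqF//.
by rewrite powR1 mul1r.
Qed.

(** Estimates of this kind do not distinguish weights that dominate each other
    up to a constant. *)
Definition weight_monotone (P : (nat -> R) -> Prop) : Prop :=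
  forall (w1 w2 : nat -> R) A, 0 < A -> (forall p, 0 <= w1 p) ->
    (forall p, w1 p <= A * w2 p) -> P w1 -> P w2.

Lemma quant_geometric_factor k (P : (nat -> R) -> Prop) : weight_monotone P ->
  quant k (fun t => P (Mseq sigma t)) <->
  quant k (fun t => quant k (fun h => P (hMseq h t))).
Proof.
move=> Pmono; case: k => /=; split.
- by case=> t [t_gt0 Pt]; exists t; split=> //; exists 1; rewrite hMseq1.
- case=> t [t_gt0 [h [h_gt0 Pth]]]; exists (t + 1).
  rewrite addr_gt0//; split=> //.
  have lt_t : t < t + 1 by rewrite ltrDl.
  have [A A_gt0 le_A] := geometric_factor_absorbed _ _ _ h_gt0 lt_t.
  by apply: Pmono A_gt0 _ le_A Pth; exact: hMseq_ge0.
- move=> Pt t t_gt0 h h_gt0.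
  have lt_t : t / 2 < t by rewrite ltr_pdivrMr// ltr_pMr// ltr1n.
  have [A A_gt0 le_A] := geometric_factor_gained _ _ _ h_gt0 lt_t.
  by apply: Pmono A_gt0 _ le_A (Pt _ _); [exact: Mseq_ge0 | rewrite divr_gt0].
- by move=> Pth t t_gt0; rewrite -hMseq1; exact: Pth.
Qed.

End GeometricFactor.

Lemma eq_quant (R : realType) k (P Q : R -> Prop) :
  (forall t, 0 < t -> P t <-> Q t) -> quant k P <-> quant k Q.
Proof.
move=> PQ; case: k => /=; split.
- by case=> t [t_gt0 /(PQ _ t_gt0) Qt]; exists t.
- by case=> t [t_gt0 /(PQ _ t_gt0) Pt]; exists t.
- by move=> Pt t t_gt0; apply/PQ => //; exact: Pt.
- by move=> Qt t t_gt0; apply/PQ => //; exact: Qt.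
Qed.

Section WeightedEstimates.
Context {R : realType} {I J : Type} (N : I -> J -> \bar R).

(** In the spaces with a single matrix, only the index [j] that the weight
    depends on enters uniformly. *)
Lemma single_weight_monotone (size : J -> nat) :
  weight_monotone (fun w => forall i, exists C : R, 0 < C /\
    forall j, (N i j <= (C * w (size j))%:E)%E).
Proof.
move=> w1 w2 A A_gt0 _ le_w P1 i; have [C [C_gt0 leC]] := P1 i.
exists (C * A); rewrite mulr_gt0//; split=> // j.
by apply: le_trans (leC j) _; rewrite lee_fin -mulrA ler_wpM2l ?(ltW C_gt0).
Qed.

Lemma double_weight_monotone (sizeI : I -> nat) (sizeJ : J -> nat) :
  weight_monotone (fun w => exists C : R, 0 < C /\
    forall i j, (N i j <= (C * w (sizeI i) * w (sizeJ j))%:E)%E).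
Proof.
move=> w1 w2 A A_gt0 w1_ge0 le_w [C [C_gt0 leC]].
exists (C * A * A); rewrite !mulr_gt0//; split=> // i j.
apply: le_trans (leC i j) _; rewrite lee_fin.
have -> : C * A * A * w2 (sizeI i) * w2 (sizeJ j) =
    C * (A * w2 (sizeI i)) * (A * w2 (sizeJ j)).
  by rewrite !mulrA -!(mulrAC _ A).
by rewrite ler_pM ?mulr_ge0 ?ler_wpM2l ?(ltW C_gt0).
Qed.

End WeightedEstimates.

Theorem theorem3p3 (R : realType) (n : nat) (sigma : R) (hsigma : 1 < sigma)
    (k : regime) :
  [/\ @S_both R n k sigma = @scrS_both R n k sigma,
      @S_up R n k sigma = @scrS_up R n k sigma
    & @S_down R n k sigma = @scrS_down R n k sigma].
Proof.
have sigma_ge0 : 0 <= sigma by exact: le_trans (ltW hsigma).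
split; apply/funext => phi; apply/propext; apply: and_iff_compat_l.
- have /(quant_geometric_factor sigma_ge0 k) E := double_weight_monotone
    (fun alpha beta : multi_index n => sup_norm alpha beta phi)
    (@mabs n) (@mabs n).
  apply: (iff_trans E); apply: eq_quant => t t_gt0; apply: eq_quant => h h_gt0.
  have EC C (a b : nat) :
      C * @hMseq R sigma h t a * @hMseq R sigma h t b =
      C * h `^ (a%:R `^ sigma + b%:R `^ sigma)
        * Mseq sigma t a * Mseq sigma t b.
    rewrite /hMseq powRD ?(gt_eqF h_gt0) ?implybT// !mulrA.
    by rewrite (mulrAC _ (Mseq _ _ _) (h `^ _)).
  by split=> -[C [C_gt0 leC]]; exists C; split=> // alpha beta;
    move: (leC alpha beta); rewrite EC.
- have /(quant_geometric_factor sigma_ge0 k) E := single_weight_monotone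
    (fun alpha beta : multi_index n => sup_norm alpha beta phi) (@mabs n).
  apply: (iff_trans E); apply: eq_quant => t _; apply: eq_quant => h _.
  by split=> P alpha; have [C [C_gt0 leC]] := P alpha; exists C; split=> // beta;
    move: (leC beta); rewrite /hMseq mulrA.
- have /(quant_geometric_factor sigma_ge0 k) E := single_weight_monotone
    (fun beta alpha : multi_index n => sup_norm alpha beta phi) (@mabs n).
  apply: (iff_trans E); apply: eq_quant => t _; apply: eq_quant => h _.
  by split=> P beta; have [C [C_gt0 leC]] := P beta; exists C; split=> // alpha;
    move: (leC alpha); rewrite /hMseq mulrA.
Qed.
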